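(* Let $\star$ be a star operation of finite character on an integral domain $D$. Then $D$ is a $\star$-Schreier domain if and only if $\mathrm{Inv}_{\star}(D)$, under $\star$-multiplication and with the order defined by $A\leq B\Leftrightarrow A\supseteq B$, is a Riesz group.
   Context: $D$ is an integral domain with quotient field $K\neq D$; $F(D)$ (resp. $f(D)$) is the set of nonzero (resp. nonzero finitely generated) fractional ideals of $D$. A star operation on $D$ is a map $I\mapsto I^{\star}$ on $F(D)$ such that for all $I,J\in F(D)$ and $0\ne x\in K$: $(x)^{\star}=(x)$ and $(xI)^{\star}=xI^{\star}$; $I\subseteq I^{\star}$, and $I\subseteq J$ implies $I^{\star}\subseteq J^{\star}$; $(I^{\star})^{\star}=I^{\star}$. It is of finite character if $I^{\star}=\bigcup\{J^{\star}: J\subseteq I,\ J\in f(D)\}$ for all $I\in F(D)$. $I\in F(D)$ is a $\star$-ideal if $I^{\star}=I$, and is $\star$-invertible if $(II^{-1})^{\star}=D$, where $I^{-1}=\{x\in K: xI\subseteq D\}$. $\star$-multiplication is $(I,J)\mapsto (IJ)^{\star}$. $\mathrm{Inv}_{\star}(D)$ is the group of $\star$-invertible fractional $\star$-ideals of $D$ under $\star$-multiplication, and $\mathcal I_{\star}(D)$ is the monoid of those contained in $D$ (the integral ones), both ordered by $I\le J\Leftrightarrow I\supseteq J$. $I\in\mathcal I_{\star}(D)$ is primal if whenever $J,K'\in \mathcal I_{\star}(D)$ and $I\le (JK')^{\star}$ there are $I_1,I_2\in\mathcal I_{\star}(D)$ with $I=(I_1I_2)^{\star}$, $I_1\le J$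 and $I_2\le K'$. $D$ is $\star$-Schreier if every $I\in\mathcal I_{\star}(D)$ (every integral $\star$-invertible $\star$-ideal) is primal. A Riesz group is a directed partially ordered (abelian) group $G$ with the Riesz interpolation property: whenever $p,q\le r,s$ in $G$ there is $t\in G$ with $p,q\le t\le r,s$. *)

(* Defs.v *)
From HB Require Import structures.
From mathcomp Require Import all_boot all_order all_algebra.
From mathcomp Require Import boolp classical_sets.

Set Implicit Arguments.
Unset Strict Implicit.
Unset Printing Implicit Defensive.

Import GRing.Theory.
Local Open Scope ring_scope.
Local Open Scope classical_set_scope.

Local Notation "x %:F" := (tofrac x) : ring_scope.

(* D is viewed inside its quotient field {fraction D} as range (@tofrac D). *)
Section Ideals.
Variable D : idomainType.
Local Notation K := {fraction D}.

(* Nonzero fractional ideals; the zero ideal is excluded by fi_neq0. *)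
Record fracIdeal := FracIdeal {
  fi_set :> set K;
  fi_add : forall x y, fi_set x -> fi_set y -> fi_set (x + y);
  fi_scale : forall (a : D) x, fi_set x -> fi_set (a%:F * x);
  fi_denom : exists d : D,
    d != 0 /\ forall x, fi_set x -> range (@tofrac D) (d%:F * x);
  fi_neq0 : exists x, fi_set x /\ x != 0 }.

Implicit Types (I J L : fracIdeal) (x y : K).

Lemma fi_eq I J : (I : set K) = J -> I = J.
Proof.
case: I J => I a b c d [J a' b' c' d'] /= E; subst J.
by congr FracIdeal; exact: Prop_irrelevance.
Qed.

Lemma fi0 I : fi_set I 0.
Proof.
by case: (fi_neq0 I) => x [Ix _]; have := fi_scale 0 Ix; rewrite tofrac0 mul0r.
Qed.

Lemma fi_sum I (T : eqType) (r : seq T) (F : T -> K) :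
  (forall i, i \in r -> fi_set I (F i)) -> fi_set I (\sum_(i <- r) F i).
Proof.
move=> H; rewrite big_seq; elim/big_ind: _ => //; first exact: fi0.
exact: fi_add.
Qed.

Lemma fi_numer I : exists a : D, a != 0 /\ fi_set I a%:F.
Proof.
case: (fi_neq0 I) => x [Ix x0]; case: (fi_denom I) => d [d0 /(_ _ Ix)[a _ E]].
exists a; split; last by rewrite E; exact: fi_scale.
by rewrite -tofrac_eq0 E mulf_neq0 // tofrac_eq0.
Qed.

Lemma frac_denom x : exists d : D, d != 0 /\ range (@tofrac D) (d%:F * x).
Proof.
elim/quotW: x => x; exists (\d_x)%R; split; first exact: denom_ratioP.
exists (\n_x)%R => //; unlock FracField.tofrac.
rewrite -[RHS]FracField.pi_mul; apply/eqmodP.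
rewrite /= FracField.equivfE /FracField.mulf /=.
by rewrite !numden_Ratio ?(oner_neq0, mul1r, mulr1, denom_ratioP) // mulrC.
Qed.

Definition fin_gen I := exists (n : nat) (g : 'I_n -> K),
  (I : set K) = [set x | exists c : 'I_n -> D, x = \sum_i (c i)%:F * g i].

Definition fi_one : fracIdeal.
Proof.
apply: (@FracIdeal (range (@tofrac D))).
- by move=> _ _ [a _ <-] [b _ <-]; exists (a + b) => //; rewrite tofracD.
- by move=> a _ [b _ <-]; exists (a * b) => //; rewrite tofracM.
- exists 1; split; first exact: oner_neq0.
  by move=> _ [a _ <-]; exists a; rewrite // tofrac1 mul1r.
- exists 1; split; last exact: oner_neq0.
  by exists 1 => //; rewrite tofrac1.
Defined.

Definition fi_principal x (x0 : x != 0) : fracIdeal.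
Proof.
apply: (@FracIdeal [set a%:F * x | a in [set: D]]).
- move=> _ _ [a _ <-] [b _ <-].
  by exists (a + b) => //; rewrite tofracD mulrDl.
- by move=> a _ [b _ <-]; exists (a * b) => //; rewrite tofracM mulrA.
- have [d [d0 [a _ E]]] := frac_denom x; exists d; split=> //.
  by move=> _ [b _ <-]; exists (b * a) => //; rewrite mulrCA -E tofracM.
- by exists x; split=> //; exists 1 => //; rewrite tofrac1 mul1r.
Defined.

Definition fi_smul x (x0 : x != 0) I : fracIdeal.
Proof.
apply: (@FracIdeal [set x * y | y in (I : set K)]).
- move=> _ _ [a Ia <-] [b Ib <-].
  by exists (a + b); rewrite ?mulrDr //; exact: fi_add.
- by move=> a _ [b Ib <-]; exists (a%:F * b); [exact: fi_scale|rewrite mulrCA].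
- have [d [d0 [a _ E]]] := frac_denom x.
  have [e [e0 He]] := fi_denom I; exists (d * e); split; first exact: mulf_neq0.
  move=> _ [b /He[c _ Ec] <-]; exists (a * c) => //.
  by rewrite !tofracM E Ec mulrACA.
- have [y [Iy y0]] := fi_neq0 I; exists (x * y).
  by split; [exists y | exact: mulf_neq0].
Defined.

Definition fi_mul I J : fracIdeal.
Proof.
apply: (@FracIdeal [set x | exists s : seq (K * K),
  (forall p, p \in s -> fi_set I p.1 /\ fi_set J p.2) /\
  x = \sum_(p <- s) p.1 * p.2]).
- move=> _ _ [s [Hs ->]] [t [Ht ->]]; exists (s ++ t); rewrite big_cat.
  by split=> // p; rewrite mem_cat => /orP[/Hs|/Ht].
- move=> a _ [s [Hs ->]]; exists [seq (a%:F * p.1, p.2) | p <- s]; split.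
    by move=> _ /mapP[p /Hs[Ip Jp] ->]; split=> //; exact: fi_scale.
  by rewrite big_map mulr_sumr; apply: eq_bigr => p _; rewrite mulrA.
- have [d [d0 Hd]] := fi_denom I; have [e [e0 He]] := fi_denom J.
  exists (d * e); split; first exact: mulf_neq0.
  move=> _ [s [Hs ->]]; rewrite mulr_sumr.
  apply: (@fi_sum fi_one) => p /Hs[/Hd[a _ Ea] /He[b _ Eb]].
  by exists (a * b) => //; rewrite !tofracM Ea Eb mulrACA.
- have [x [Ix x0]] := fi_neq0 I; have [y [Jy y0]] := fi_neq0 J.
  exists (x * y); split; last exact: mulf_neq0.
  exists [:: (x, y)]; rewrite big_seq1; split=> // p.
  by rewrite inE => /eqP ->.
Defined.

Definition fi_inv I : fracIdeal.
Proof.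
apply: (@FracIdeal [set x | forall y, fi_set I y -> range (@tofrac D) (x * y)]).
- move=> x y Hx Hy z Iz; rewrite mulrDl.
  exact: (@fi_add fi_one) (Hx _ Iz) (Hy _ Iz).
- by move=> a x Hx z Iz; rewrite -mulrA; exact: (@fi_scale fi_one) (Hx _ Iz).
- by have [a [a0 Ia]] := fi_numer I; exists a; split=> // x /(_ _ Ia); rewrite mulrC.
- by have [d [d0 Hd]] := fi_denom I; exists d%:F; rewrite tofrac_eq0.
Defined.

Lemma fi_mul_in I J x y : fi_set I x -> fi_set J y -> fi_set (fi_mul I J) (x * y).
Proof.
move=> Ix Jy; exists [:: (x, y)]; rewrite big_seq1; split=> // p.
by rewrite inE => /eqP ->.
Qed.

Lemma fi_mul_sub I J L :
  (forall x y, fi_set I x -> fi_set J y -> fi_set L (x * y)) -> fi_mul I J `<=` L.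
Proof. by move=> H _ [s [Hs ->]]; apply: fi_sum => p /Hs[]; exact: H. Qed.

Lemma fi_mulC : commutative fi_mul.
Proof.
suff H I J : fi_mul I J `<=` fi_mul J I by move=> I J; apply: fi_eq; apply/seteqP.
by apply: fi_mul_sub => x y Ix Jy; rewrite mulrC; exact: fi_mul_in.
Qed.

Lemma fi_mulS I J I' J' : I `<=` I' -> J `<=` J' -> fi_mul I J `<=` fi_mul I' J'.
Proof.
by move=> HI HJ; apply: fi_mul_sub => x y /HI Ix /HJ Jy; exact: fi_mul_in.
Qed.

Lemma fi_mulA : associative fi_mul.
Proof.
move=> I J L; apply: fi_eq; apply/seteqP; split; apply: fi_mul_sub.
  move=> x _ Ix [s [Hs ->]]; rewrite mulr_sumr.
  by apply: fi_sum => p /Hs[Jp Lp]; rewrite mulrA; do 2?apply: fi_mul_in.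
move=> _ z [s [Hs ->]] Lz; rewrite mulr_suml.
by apply: fi_sum => p /Hs[Ip Jp]; rewrite -mulrA; do 2?apply: fi_mul_in.
Qed.

Lemma fi_mul1 : left_id fi_one fi_mul.
Proof.
move=> I; apply: fi_eq; apply/seteqP; split.
  by apply: fi_mul_sub => _ x [a _ <-]; exact: fi_scale.
move=> x Ix; rewrite -[x]mul1r; apply: fi_mul_in => //.
by exists 1; rewrite ?tofrac1.
Qed.

Lemma fi_mulV_sub I : fi_mul I (fi_inv I) `<=` fi_one.
Proof. by apply: fi_mul_sub => x y Ix /(_ _ Ix); rewrite mulrC. Qed.

Lemma fi_inv_max I J : fi_mul I J `<=` fi_one -> J `<=` fi_inv I.
Proof. by move=> H y Jy x Ix; rewrite mulrC; apply: H; exact: fi_mul_in. Qed.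

Record star_operation := StarOperation {
  star :> fracIdeal -> fracIdeal;
  star_principal : forall x (x0 : x != 0),
    star (fi_principal x0) = fi_principal x0;
  star_smul : forall x (x0 : x != 0) I,
    star (fi_smul x0 I) = fi_smul x0 (star I);
  star_ext : forall I, I `<=` star I;
  star_mono : forall I J, I `<=` J -> star I `<=` star J;
  star_idem : forall I, star (star I) = star I }.

Definition finite_character (s : star_operation) :=
  forall I, (s I : set K) =
    \bigcup_(J in [set J : fracIdeal | J `<=` I /\ fin_gen J]) (s J : set K).

Section Star.
Variable s : star_operation.

Definition star_ideal I := s I = I.

Definition star_invertible I := s (fi_mul I (fi_inv I)) = fi_one.

Definition star_mul I J := s (fi_mul I J).

(* I <= J on fractional ideals means that I contains J. *)
Definition fi_le I J := J `<=` I.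

Definition integral_Inv I :=
  [/\ star_ideal I, star_invertible I & I `<=` range (@tofrac D)].

Definition primal I := integral_Inv I /\
  forall J L, integral_Inv J -> integral_Inv L -> fi_le I (star_mul J L) ->
  exists I1 I2, [/\ integral_Inv I1, integral_Inv I2, I = star_mul I1 I2,
                    fi_le I1 J & fi_le I2 L].

Definition star_Schreier := forall I, integral_Inv I -> primal I.

Lemma star_one : s fi_one = fi_one.
Proof.
have x0 : (1 : K) != 0 by exact: oner_neq0.
suff -> : fi_one = fi_principal x0 by exact: star_principal.
apply: fi_eq; rewrite /=; congr (_ @` _); apply/funext => a.
by rewrite mulr1.
Qed.

Lemma star_min I J : I `<=` s J -> s I `<=` s J.
Proof. by move=> /(@star_mono s); rewrite star_idem. Qed.

Lemma star_min1 I : I `<=` fi_one -> s I `<=` fi_one.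
Proof. by rewrite -{1}star_one => /star_min; rewrite star_one. Qed.

Lemma star_mull I J : s (fi_mul (s I) J) = s (fi_mul I J).
Proof.
apply: fi_eq; apply/seteqP; split; last first.
  by apply: star_mono; apply: fi_mulS => //; exact: star_ext.
apply: star_min; apply: fi_mul_sub => x y sx Jy.
have [->|y0] := eqVneq y 0; first by rewrite mulr0; exact: fi0.
have : fi_set (s (fi_smul y0 I)) (x * y).
  by rewrite star_smul; exists x; rewrite // mulrC.
apply: star_mono => _ [z Iz <-]; rewrite mulrC; exact: fi_mul_in.
Qed.

Lemma star_mulr I J : s (fi_mul I (s J)) = s (fi_mul I J).
Proof. by rewrite fi_mulC star_mull fi_mulC. Qed.

Lemma star_invertibleI I J : s (fi_mul I J) = fi_one -> star_invertible I.
Proof.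
move=> E; apply: fi_eq; apply/seteqP; split.
  by apply: star_min1; exact: fi_mulV_sub.
rewrite -{1}E; apply: star_mono; apply: fi_mulS => //; apply: fi_inv_max.
by rewrite -E; exact: star_ext.
Qed.

(* The carrier of the group Inv_s(D), whose law is (A, B) |-> s (A B). *)
Record Inv := MkInv {
  inv_ideal :> fracIdeal;
  inv_star : star_ideal inv_ideal;
  inv_invertible : star_invertible inv_ideal }.

Lemma inv_eq (A B : Inv) : (A : fracIdeal) = B -> A = B.
Proof.
case: A B => A a b [B a' b'] /= E; subst B.
by congr MkInv; exact: Prop_irrelevance.
Qed.

Lemma one_invertible : star_invertible fi_one.
Proof. by apply: (@star_invertibleI _ fi_one); rewrite fi_mul1 star_one. Qed.

Lemma mul_star_ideal I J : star_ideal (star_mul I J).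
Proof. exact: star_idem. Qed.

Lemma mul_invertible I J : star_invertible I -> star_invertible J ->
  star_invertible (star_mul I J).
Proof.
move=> EI EJ.
apply: (@star_invertibleI _ (fi_mul (fi_inv I) (fi_inv J))).
rewrite star_mull fi_mulA -(fi_mulA I) (fi_mulC J) (fi_mulA I) -(fi_mulA _ J).
by rewrite -star_mull EI fi_mul1.
Qed.

Lemma inv_star_ideal I : star_invertible I -> star_ideal (fi_inv I).
Proof.
move=> EI; apply: fi_eq; apply/seteqP; split; last exact: star_ext.
by apply: fi_inv_max; rewrite -EI -star_mulr; exact: star_ext.
Qed.

Lemma inv_star_invertible I : star_invertible I -> star_invertible (fi_inv I).
Proof. by move=> EI; apply: (@star_invertibleI _ I); rewrite fi_mulC. Qed.

Definition Inv_one : Inv := MkInv star_one one_invertible.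

Definition Inv_mul (A B : Inv) : Inv :=
  MkInv (mul_star_ideal A B)
    (mul_invertible (inv_invertible A) (inv_invertible B)).

Definition Inv_inv (A : Inv) : Inv :=
  MkInv (inv_star_ideal (inv_invertible A))
    (inv_star_invertible (inv_invertible A)).

Lemma Inv_mulC : commutative Inv_mul.
Proof. by move=> A B; apply: inv_eq; rewrite /= /star_mul fi_mulC. Qed.

Lemma Inv_mulA : associative Inv_mul.
Proof.
by move=> A B C; apply: inv_eq; rewrite /= /star_mul star_mulr star_mull fi_mulA.
Qed.

Lemma Inv_mul1 : left_id Inv_one Inv_mul.
Proof.
by move=> A; apply: inv_eq; rewrite /= /star_mul fi_mul1; exact: inv_star.
Qed.

Lemma Inv_mulV : left_inverse Inv_one Inv_inv Inv_mul.
Proof.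
move=> A; apply: inv_eq; rewrite /= /star_mul fi_mulC.
exact: (inv_invertible A).
Qed.

Lemma Inv_mulr1 : right_id Inv_one Inv_mul.
Proof. by move=> A; rewrite Inv_mulC Inv_mul1. Qed.

Lemma Inv_mulrV : right_inverse Inv_one Inv_inv Inv_mul.
Proof. by move=> A; rewrite Inv_mulC Inv_mulV. Qed.

HB.instance Definition _ := gen_eqMixin Inv.
HB.instance Definition _ := gen_choiceMixin Inv.
HB.instance Definition _ :=
  isGroup.Build Inv Inv_mulA Inv_mul1 Inv_mulr1 Inv_mulV Inv_mulrV.

End Star.
End Ideals.

(* A directed partially ordered abelian group, written multiplicatively, with
   the Riesz interpolation property. *)
Record riesz_group (G : groupType) (le : G -> G -> Prop) : Prop := RieszGroup {
  rg_comm : forall p q : G, commute p q;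
  rg_refl : forall p, le p p;
  rg_antisym : forall p q, le p q -> le q p -> p = q;
  rg_trans : forall q p r, le p q -> le q r -> le p r;
  rg_mul : forall p q r, le p q -> le (p * r)%g (q * r)%g;
  rg_directed : forall p q, exists r, le p r /\ le q r;
  rg_interpolation : forall p q r s,
    le p r -> le p s -> le q r -> le q s ->
    exists t, [/\ le p t, le q t, le t r & le t s] }.

(* Main.v *)
Require Import Defs.
From mathcomp Require Import all_boot all_algebra.
From mathcomp Require Import classical_sets.

(** The [s]-Schreier condition is a statement about the partially ordered
    group [Inv s] alone. The integral [s]-invertible [s]-ideals are exactly the
    elements above the identity, so primality of all of them is the Riesz
    decomposition property: a positive element below a product of two positive
    elements is itself a product of positive elements lying below the
    respective factors ([star_Schreier_decomposition]).

    In any commutative partially ordered group, decomposition and interpolation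
    are equivalent. If [p, q <= r, s], then [r / p <= (r / q) * (s / p)], because
    the quotient of the two sides is [s / q >= 1]. Decomposing [r / p = u * v]
    accordingly, the element [v * p = r / u] lies between the two pairs
    ([decomposition_interpolation]). Conversely, if [x <= y * z] with all three
    positive, then [1] and [x / z] lie below [x] and [y]; an interpolant [t]
    yields the factorization [x = t * (x / t)] ([interpolation_decomposition]).

    As for the other axioms of a Riesz group, translations preserve inclusion
    because star operations are monotone, and [Inv s] is directed because two
    fractional ideals always have a nonzero element in common, whose principal
    ideal is an upper bound of both ([Inv_directed]). *)

Set Implicit Arguments.
Unset Strict Implicit.
Unset Printing Implicit Defensive.

Definition riesz_decomposition (G : groupType) (le : G -> G -> Prop) :=
  forall x y z : G, le 1%g x -> le 1%g y -> le 1%g z -> le x (y * z)%g ->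
  exists u v, [/\ le 1%g u, le 1%g v, x = (u * v)%g, le u y & le v z].

Lemma le_mulgI (G : groupType) (le : G -> G -> Prop)
    (le_mul : forall p q r, le p q -> le (p * r)%g (q * r)%g) (p q r : G) :
  le (p * r)%g (q * r)%g -> le p q.
Proof. by move=> /(le_mul _ _ r^-1%g); rewrite !mulgK. Qed.

(** The upper bounds [r] and [s] enter through the factors [r / q] and [s / p]
    of a bound on [r / p]; decomposing [r / p] splits the way from [p] up to [r]
    at a point that is also comparable with [q] and [s]. *)
Lemma decomposition_interpolation (G : groupType) (le : G -> G -> Prop)
    (mulC : forall p q : G, commute p q)
    (le_mul : forall p q r, le p q -> le (p * r)%g (q * r)%g)
    (dec : riesz_decomposition le) (p q r s : G) :
  le p r -> le p s -> le q r -> le q s ->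
  exists t, [/\ le p t, le q t, le t r & le t s].
Proof.
move=> pr ps qr qs.
have divP a b : le a b -> le 1%g (b / a)%g.
  by move=> /(le_mul _ _ a^-1%g); rewrite mulgV.
have le_dec : le (r / p)%g ((r / q) * (s / p))%g.
  have -> : ((r / q) * (s / p) = (s / q) * (r / p))%g.
    rewrite (mulC (s / q)%g) -!mulgA; congr (r * _)%g.
    by rewrite [RHS]mulgA [RHS]mulC (mulC p^-1%g).
  by have := le_mul _ _ (r / p)%g (divP _ _ qs); rewrite mul1g.
have [u [v [u1 v1 Euv ur vs]]] := dec _ _ _ (divP _ _ pr) (divP _ _ qr)
  (divP _ _ ps) le_dec.
have Er : (v * p * u)%g = r by rewrite mulC mulgA -Euv mulgVK.
(* Seen from below, [v * p] is [p] raised by at most [s / p]; seen from above,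
   it is [r] lowered by [u], hence by at most [r / q]. *)
exists (v * p)%g; split.
- by have := le_mul _ _ p v1; rewrite mul1g.
- apply: (le_mulgI le_mul (r := u)); rewrite Er mulC.
  by have := le_mul _ _ q ur; rewrite mulgVK.
- by have := le_mul _ _ (v * p)%g u1; rewrite mul1g (mulC u) Er.
- by have := le_mul _ _ p vs; rewrite mulgVK.
Qed.

(** A first factor [t] of [x] is suitable exactly when it is above [1] and
    [x / z] (the latter puts the cofactor [x / t] below [z]) and below [x] and
    [y] (the former makes the cofactor positive): an interpolation problem. *)
Lemma interpolation_decomposition (G : groupType) (le : G -> G -> Prop) :
  riesz_group le -> riesz_decomposition le.
Proof.
move=> [mulC _ _ _ le_mul _ interp] x y z x1 y1 z1 xyz.
have xz_y : le (x / z)%g y by have := le_mul _ _ z^-1%g xyz; rewrite mulgK.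
have xz_x : le (x / z)%g x.
  apply: (le_mulgI le_mul (r := z)); rewrite mulgVK mulC.
  by have := le_mul _ _ x z1; rewrite mul1g.
have [t [t1 xzt tx ty]] := interp _ _ _ _ x1 y1 xz_x xz_y.
exists t, (x / t)%g; split=> //.
- by have := le_mul _ _ t^-1%g tx; rewrite mulgV.
- by rewrite mulC mulgVK.
- apply: (le_mulgI le_mul (r := t)); rewrite mulgVK mulC.
  by have := le_mul _ _ z xzt; rewrite mulgVK.
Qed.

Local Open Scope ring_scope.
Local Open Scope classical_set_scope.

Lemma integral_InvP (D : idomainType) (s : star_operation D) (A : Inv s) :
  fi_le (1%g : Inv s) A -> integral_Inv s A.
Proof. by move=> A1; split; [exact: inv_star | exact: inv_invertible |]. Qed.

(** The positive cone of [Inv s] consists of the integral ideals, which turns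
    primality into the decomposition property. *)
Lemma star_Schreier_decomposition (D : idomainType) (s : star_operation D) :
  star_Schreier s <-> riesz_decomposition (fun A B : Inv s => fi_le A B).
Proof.
split=> [schreier A B C A1 B1 C1 ABC | dec I intI].
  have [_ /(_ B C (integral_InvP B1) (integral_InvP C1) ABC)] :=
    schreier A (integral_InvP A1).
  move=> [I1 [I2 [[star1 inv1 int1] [star2 inv2 int2] E le1 le2]]].
  exists (MkInv star1 inv1), (MkInv star2 inv2); split=> //.
  exact: Defs.inv_eq.
split=> // J L [starJ invJ intJ] [starL invL intL] IJL.
case: intI => starI invI intI.
have [U [V [U1 V1 E UJ VL]]] :=
  dec (MkInv starI invI) (MkInv starJ invJ) (MkInv starL invL) intI intJ intL IJL.
exists U, V; split=> //; [exact: integral_InvP | exact: integral_InvP |].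
exact: (congr1 (@inv_ideal D s) E).
Qed.

Lemma principal_invertible (D : idomainType) (s : star_operation D)
    (x : {fraction D}) (x0 : x != 0) : star_invertible s (fi_principal x0).
Proof.
have y0 : x^-1 != 0 by rewrite GRing.invr_eq0.
apply: (@star_invertibleI D s _ (fi_principal y0)); rewrite -(star_one s).
congr (s _); apply: fi_eq; apply/seteqP; split.
  apply: fi_mul_sub => _ _ [a _ <-] [b _ <-]; exists (a * b) => //.
  by rewrite GRing.mulrACA GRing.mulfV // GRing.mulr1 tofracM.
move=> _ [a _ <-]; rewrite -(GRing.mulfK x0 (tofrac a)).
apply: fi_mul_in; first by exists a.
by exists 1 => //; rewrite tofrac1 GRing.mul1r.
Qed.

(** Nonzero numerators [a] of [A] and [b] of [B] give the common nonzero
    element [a * b], because [a] and [b] themselves lie in [D]. *)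
Lemma Inv_directed (D : idomainType) (s : star_operation D) (A B : Inv s) :
  exists C : Inv s, fi_le A C /\ fi_le B C.
Proof.
have [a [a0 Aa]] := fi_numer A; have [b [b0 Bb]] := fi_numer B.
have ab0 : tofrac (a * b) != 0 by rewrite tofrac_eq0 GRing.mulf_neq0.
exists (MkInv (star_principal s ab0) (principal_invertible s ab0)).
split=> _ [c _ <-]; apply: fi_scale; rewrite tofracM; last exact: fi_scale.
by rewrite GRing.mulrC; exact: fi_scale.
Qed.

Theorem proposition2p5 (D : idomainType)
    (D_proper : range (@tofrac D) <> [set: {fraction D}]%classic)
    (s : star_operation D) (s_fin : finite_character s) :
  star_Schreier s <->
  riesz_group (fun A B : Inv s => fi_le A B).
Proof.
split=> [/star_Schreier_decomposition dec | /interpolation_decomposition dec];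
  last exact/star_Schreier_decomposition.
have mulC (A B : Inv s) : commute A B by exact: Inv_mulC.
have le_mul (A B C : Inv s) : fi_le A B -> fi_le (A * C)%g (B * C)%g.
  by move=> AB; apply: star_mono; exact: fi_mulS.
split=> //.
- by move=> A.
- by move=> A B AB BA; apply: Defs.inv_eq; apply: fi_eq; apply/seteqP.
- by move=> B A C AB BC; exact: subset_trans BC AB.
- exact: Inv_directed.
- exact: (decomposition_interpolation mulC le_mul dec).
Qed.
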